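(* Let $\nu$ be an ergodic $S$-invariant Borel probability measure on $X_\eta$ with $\nu(Y)=1$. Then there exists an ergodic $S\times S$-invariant probability measure $\widetilde\rho$ on $X_\eta\times\{0,1\}^{\mathbb Z}$ whose projection onto the first coordinate is the Mirsky measure $\nu_{\mathscr B}$ and such that $M_*(\widetilde\rho)=\nu$.
   Context: Let $S$ be the shift on $\{0,1\}^{\mathbb Z}$, $(Sx)(n)=x(n+1)$. Let $\mathscr{B}=\{b_1,b_2,\dots\}\subset\{2,3,\dots\}$ with $\gcd(b_i,b_j)=1$ for $i\ne j$ and $\sum_i1/b_i<\infty$. Define $\eta(n)=1$ iff $b_i\nmid n$ for all $i$ (else $0$), and let $X_\eta$ be the set of $y\in\{0,1\}^{\mathbb Z}$ all of whose finite blocks occur in $\eta$; equivalently $y\in X_\eta$ iff $|\mathrm{supp}(y)\bmod b_i|<b_i$ for all $i$, where $\mathrm{supp}(y)=\{n:y(n)=1\}$. Let $Y=\{x\in X_\eta: |\mathrm{supp}(x)\bmod b_i|=b_i-1\ \text{for all } i\ge1\}$. Let $\Omega=\prod_i\mathbb Z/b_i\mathbb Z$ with Haar measure $\mathbb P$ and $\varphi(\omega)(n)=1$ iff $\omega(i)+n\not\equiv 0\pmod{b_i}$ for all $i$; the Mirsky measure is $\nu_{\mathscr B}=\varphi_*\mathbb P$. The map $M:X_\eta\times\{0,1\}^{\mathbb Z}\to X_\eta$ is $M(x,u)(n)=x(n)u(n)$. *)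

(* Defs.v *)
From HB Require Import structures.
From mathcomp Require Import all_boot all_order all_algebra.
From mathcomp Require Import all_classical all_reals all_analysis.
Set Implicit Arguments. Unset Strict Implicit. Unset Printing Implicit Defensive.
Import Order.TTheory GRing.Theory Num.Theory.
Local Open Scope classical_set_scope.
Local Open Scope ring_scope.

Definition bseq := int -> bool.

(** Generators of the product (= Borel, for the product topology)
    sigma-algebra: the coordinate cylinders {x | x n = 1}. *)
Definition bseq_gen : set (set bseq) :=
  fun A => exists n : int, A = [set x : bseq | x n = true].

Definition BinSeq := g_sigma_algebraType bseq_gen.

Definition shiftS (x : BinSeq) : BinSeq := fun n => x (n + 1).

Definition shiftSS (p : (BinSeq * BinSeq)%type) : (BinSeq * BinSeq)%type :=
  (shiftS p.1, shiftS p.2).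

Definition etaB (b : nat -> nat) : BinSeq :=
  fun n => `[< forall i : nat, ~ ((b i)%:Z %| n)%Z >].

Definition X_eta (b : nat -> nat) : set BinSeq :=
  [set y : BinSeq | forall (m : int) (k : nat), exists t : int,
     forall j : nat, (j < k)%N -> y (m + j%:Z) = etaB b (t + j%:Z)].

Definition supp_mod (b : nat -> nat) (x : BinSeq) (i : nat) : {set 'Z_(b i)} :=
  [set r : 'Z_(b i) | `[< exists n : int, x n = true /\
                                  (n %% (b i)%:Z)%Z = (nat_of_ord r)%:Z >] ].

Definition Yset (b : nat -> nat) : set BinSeq :=
  X_eta b `&` [set x | forall i : nat, #|supp_mod b x i| = (b i).-1].

(** (wrapped in a record so that it can carry canonical structures;
    the coercion lets one write [w i] for the i-th coordinate) *)
Record OmegaB (b : nat -> nat) :=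
  MkOmega { omega_val :> forall i : nat, 'Z_(b i) }.

HB.instance Definition _ (b : nat -> nat) := gen_eqMixin (OmegaB b).
HB.instance Definition _ (b : nat -> nat) := gen_choiceMixin (OmegaB b).
HB.instance Definition _ (b : nat -> nat) :=
  isPointed.Build (OmegaB b) (MkOmega (fun i : nat => (0 : 'Z_(b i))%R)).

Definition omega_gen (b : nat -> nat) : set (set (OmegaB b)) :=
  fun A => exists (i : nat) (a : 'Z_(b i)), A = (fun w : OmegaB b => w i = a).

Definition OmegaT (b : nat -> nat) := g_sigma_algebraType (@omega_gen b).

Definition omega_add (b : nat -> nat) (t w : OmegaT b) : OmegaT b :=
  MkOmega (fun i => (w i + t i)%R).

Definition is_haar (R : realType) (b : nat -> nat) (P : probability (OmegaT b) R) :=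
  forall (t : OmegaT b) (A : set (OmegaT b)),
    measurable A -> P (omega_add t @^-1` A) = P A.

Definition phiB (b : nat -> nat) (w : OmegaT b) : BinSeq :=
  fun n => `[< forall i : nat,
                ~ ((b i)%:Z %| (nat_of_ord (w i))%:Z + n)%Z >].

Definition Mmap (p : (BinSeq * BinSeq)%type) : BinSeq := fun n => p.1 n && p.2 n.

Definition invariant d (T : measurableType d) (R : realType)
    (mu : probability T R) (f : T -> T) :=
  forall A : set T, measurable A -> mu (f @^-1` A) = mu A.

Definition ergodic d (T : measurableType d) (R : realType)
    (mu : probability T R) (f : T -> T) :=
  invariant mu f /\
  forall A : set T, measurable A -> f @^-1` A = A ->
    mu A = 0%E \/ mu A = 1%E.

(* Main.v *)
Require Import Defs.
From HB Require Import structures.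
From mathcomp Require Import all_boot all_order all_algebra.
From mathcomp Require Import all_classical all_reals all_analysis.
From mathcomp Require Import zify ring lra.
Import Order.TTheory GRing.Theory Num.Theory.
Local Open Scope classical_set_scope.
Local Open Scope ring_scope.

(** A point x of Y misses exactly one residue class modulo each b_i; let
    theta(x)(i) be minus that class.  Then theta intertwines the shift with the
    rotation by (1, 1, ...) on Omega, which is uniquely ergodic, so theta maps nu
    to the Haar measure.  Moreover x <= phi(theta(x)) coordinatewise, i.e.
    M(phi(theta(x)), x) = x, so the image of nu under x |-> (phi(theta(x)), x) is
    the required joining; it is ergodic as a factor of nu. *)

(** * Coprime moduli and the Chinese remainder theorem *)

Lemma coprime_prod_ord (b : nat -> nat) (m K : nat) :
  (forall i, (i < K)%N -> coprime m (b i)) -> coprime m (\prod_(i < K) b i).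
Proof.
by move=> h; elim/big_ind: _ => [|x y|i _]; rewrite ?coprimen1 ?coprimeMr;
  [|move=> -> ->|exact: h].
Qed.

Lemma dvdn_prod_ord (b : nat -> nat) (m K : nat) :
  (forall i j, i <> j -> coprime (b i) (b j)) ->
  (forall i, (i < K)%N -> (b i %| m)%N) -> (\prod_(i < K) b i %| m)%N.
Proof.
move=> hcop; elim: K => [|K IH] h; first by rewrite big_ord0 dvd1n.
rewrite big_ord_recr /= Gauss_dvd.
  by rewrite h // IH // => i iK; apply: h; rewrite ltnS ltnW.
rewrite coprime_sym; apply: coprime_prod_ord => i iK; apply: hcop.
by move=> e; rewrite e ltnn in iK.
Qed.

(** Induction on [K] with the two-modulus [chinese]; reduction modulo the product then gives the
    bound. The bound lets the cylinders of level [K] be listed by the finitely many [n] below the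
    product. *)
Lemma crt_ord (b : nat -> nat) (hb : forall i, (2 <= b i)%N)
    (hcop : forall i j, i <> j -> coprime (b i) (b j)) (a : nat -> nat) (K : nat) :
  exists n : nat, (n < \prod_(i < K) b i)%N /\
    forall i, (i < K)%N -> n = a i %[mod b i].
Proof.
suff [n hn] : exists n : nat, forall i, (i < K)%N -> n = a i %[mod b i].
  exists (n %% \prod_(i < K) b i)%N; split.
    by rewrite ltn_mod prodn_gt0 // => i; apply: ltnW.
  move=> i iK; rewrite -hn // modn_dvdm //.
  by rewrite (bigD1 (Ordinal iK)) //= dvdn_mulr.
elim: K => [|K [n hn]]; first by exists 0%N.
have cop : coprime (\prod_(i < K) b i) (b K).
  rewrite coprime_sym; apply: coprime_prod_ord => i iK; apply: hcop.
  by move=> e; rewrite e ltnn in iK.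
exists (chinese (\prod_(i < K) b i) (b K) n (a K)) => i.
rewrite ltnS leq_eqVlt => /predU1P[->|iK]; first exact: chinese_modr.
rewrite -hn // -(modn_dvdm (m := \prod_(i < K) b i)).
  by rewrite chinese_modl // modn_dvdm // (bigD1 (Ordinal iK)) //= dvdn_mulr.
by rewrite (bigD1 (Ordinal iK)) //= dvdn_mulr.
Qed.

(** * A sieve in arithmetic progressions *)

(** As [N] is invertible modulo [b], all solutions [s] lie in one residue class modulo [b], so the
    quotient of [s] by [b] determines [s]. *)
Lemma card_dvdn_progression (b N c L : nat) : (0 < b)%N -> coprime b N ->
  (#|[set s : 'I_L | (b %| c + N * s)%N]%SET| <= (L %/ b).+1)%N.
Proof.
move=> b0 cop.
pose f (s : 'I_L) : 'I_(L %/ b).+1 := inord (s %/ b)%N.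
rewrite -(card_in_imset (f := f)); last first.
  move=> s s'; rewrite !inE => ds ds' /(congr1 val) /=.
  have dv (t : 'I_L) : (t %/ b < (L %/ b).+1)%N.
    by rewrite ltnS leq_div2r // ltnW.
  rewrite !inordK ?dv // => e; apply: val_inj => /=.
  rewrite (divn_eq s b) (divn_eq s' b) e; congr (_ + _)%N.
  apply/eqP; move: ds ds'.
  wlog ss : s s' {e} / (s <= s')%N.
    move=> H ds ds'; case/orP: (leq_total s s') => h; first exact: H.
    by rewrite eq_sym; apply: H.
  move=> ds ds'; rewrite eq_sym eqn_mod_dvd // -(Gauss_dvdr _ cop).
  have -> : (N * (s' - s) = (c + N * s') - (c + N * s))%N.
    by rewrite subnDl mulnBr.
  exact: dvdn_sub.
by apply: leq_trans (max_card _) _; rewrite card_ord.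
Qed.

Lemma leq_card_bigcup (I T : finType) (P : pred I) (F : I -> {set T}) :
  (#|\bigcup_(i | P i) F i|%SET <= \sum_(i | P i) #|F i|)%N.
Proof.
apply: (big_ind2 (fun (A : {set T}) m => #|A| <= m)%N) => [|A m B p hA hB|//].
  by rewrite cards0.
by apply: leq_trans (leq_add hA hB); rewrite cardsU leq_subr.
Qed.

(** Tails of a convergent series tend to 0, and with nonnegative terms the infinite tail bounds each
    finite section. This keeps the sieve within finite sums in [R]. *)
Lemma inv_sum_tail (R : realType) (b : nat -> nat)
    (hsum : (\sum_(i <oo) ((b i)%:R^-1 : R)%:E < +oo)%E) (e : R) : 0 < e ->
  exists K : nat, forall I : nat, \sum_(K <= i < I) (b i)%:R^-1 <= e.
Proof.
move=> e0.
have nn i : true -> (0 <= ((b i)%:R^-1 : R)%:E)%E by rewrite lee_fin invr_ge0.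
have := nneseries_tail_cvg hsum (fun i _ => nn i isT).
move=> /fine_cvgP[ft /cvgrPdist_le /(_ _ e0) h].
have [K _ hK] := filterI ft h; exists K => I.
have [/= fK] := hK K (leqnn K); rewrite sub0r normrN => hKe.
rewrite -lee_fin -sumEFin; apply: le_trans (nneseries_lim_ge I _) _.
  by move=> *; exact: nn.
by rewrite -(fineK fK) lee_fin; apply: le_trans (ler_norm _) hKe.
Qed.

(* Only i with b_i <= X = O(L) can matter, and each such b_i kills at most
   L / b_i + 1 of the L candidates s; the terms 1 are bounded by X / b_i for
   i >= K1, with K1 chosen after N, so that they also sum to a small fraction of L. *)
Lemma sieve_progression (R : realType) (b : nat -> nat) (hb : forall i, (2 <= b i)%N)
    (hsum : (\sum_(i <oo) ((b i)%:R^-1 : R)%:E < +oo)%E) (k : nat) :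
  exists K0 : nat, forall K N c : nat, (K0 <= K)%N -> (0 < N)%N -> (0 < c)%N ->
    (forall i, (K <= i)%N -> coprime (b i) N) ->
    exists s : nat, forall i j, (K <= i)%N -> (j < k)%N -> ~~ (b i %| c + j + N * s)%N.
Proof.
have tail := inv_sum_tail _ _ hsum; clear hsum.
have bgt0 i : 0 < (b i)%:R :> R by rewrite ltr0n; apply: ltnW.
(* With this tail the terms [L / b i], summed over the [k] positions [j], cost at most [L / 4]; the
   successor keeps the bound meaningful for [k = 0]. *)
have e0 : 0 < (4 * k.+1%:R)^-1 :> R by rewrite invr_gt0 mulr_gt0.
have [K0 hK0] := tail _ e0.
exists K0 => K N c KK N0 c0 cop.
have hK I : \sum_(K <= i < I) (b i)%:R^-1 <= (4 * k.+1%:R)^-1 :> R.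
  apply: le_trans (hK0 I); case: (leqP K I) => KI; last first.
    by rewrite big_geq ?sumr_ge0 // ltnW.
  by rewrite (big_cat_nat KK KI) /= lerDr sumr_ge0.
(* The extra factor [N] compensates the size of [X], since [X / N <= c + k + L]. *)
have e1 : 0 < (4 * k.+1%:R * N%:R)^-1 :> R by rewrite invr_gt0 !mulr_gt0 // ltr0n.
have [K1 hK1] := tail _ e1.
(* Large enough for [L / 4 + k * K1 + (c + k + L) / 4 < L], the inequality that ends the count. *)
pose L := (4 * (k * K1 + c + k)).+1.
pose X := (c + k + N * L)%N.
have X0 : 0 < X%:R :> R by rewrite ltr0n addn_gt0 addn_gt0 c0.
(* A tail this small forces [b i >= 2 * X > X] for [i >= K2], so the relevant indices form a finite
   type. *)
have e2 : 0 < (2 * X%:R)^-1 :> R by rewrite invr_gt0 mulr_gt0.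
have [K2 hK2] := tail _ e2.
have hI i : (b i <= X)%N -> (i < K2)%N.
  rewrite -(ler_nat R) ltnNge => biX; apply/negP => K2i.
  have := hK2 i.+1; rewrite big_nat_recr //= => h.
  have : (b i)%:R^-1 <= (2 * X%:R)^-1 :> R by apply: le_trans h; rewrite lerDr sumr_ge0.
  rewrite lef_pV2 ?posrE // ?mulr_gt0 // => h'; lra.
pose bad (j : 'I_k) (i : 'I_K2) := [set s : 'I_L | (b i %| c + j + N * s)%N]%SET.
pose BAD := (\bigcup_(j < k) \bigcup_(i < K2 | (K <= i)%N && (b i <= X)%N) bad j i)%SET.
suff hB : (#|BAD| < L)%N.
  have /fintype.subsetPn[s _ sB] : ~~ ([set: 'I_L]%SET \subset BAD).
    by apply/negP => /subset_leq_card; rewrite cardsT card_ord leqNgt hB.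
  exists s => i j Ki jk; apply/negP => d.
  have biX : (b i <= X)%N.
    apply: leq_trans (dvdn_leq _ d) _; first lia.
    have := ltn_ord s => sL; rewrite /X.
    have : (N * s <= N * L)%N by rewrite leq_mul2l ltnW // orbT.
    lia.
  move/negP: sB; apply; apply/bigcupP; exists (Ordinal jk) => //.
  by apply/bigcupP; exists (Ordinal (hI _ biX)); rewrite ?inE //= Ki.
rewrite -(ltr_nat R).
have card_le (j : 'I_k) :
    #|\bigcup_(i < K2 | (K <= i)%N && (b i <= X)%N) bad j i|%SET%:R
    <= L%:R * (4 * k.+1%:R)^-1 + K1%:R + X%:R * (4 * k.+1%:R * N%:R)^-1 :> R.
  apply: (@le_trans _ _ (\sum_(i < K2 | (K <= i)%N && (b i <= X)%N)
       (L%:R * (b i)%:R^-1 + (i < K1)%:R + (K1 <= i)%:R * (X%:R * (b i)%:R^-1)))).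
    apply: (@le_trans _ _ (\sum_(i < K2 | (K <= i)%N && (b i <= X)%N) #|bad j i|%:R)).
      by rewrite -natr_sum ler_nat; exact: leq_card_bigcup.
    apply: ler_sum => i /andP[Ki biX].
    have hc : #|bad j i|%:R <= (L %/ b i).+1%:R :> R.
      by rewrite ler_nat; apply: card_dvdn_progression; [exact: ltnW|exact: cop].
    apply: (le_trans hc); rewrite -natr1 -addrA lerD //.
      by rewrite ler_pdivlMr // -natrM ler_nat leq_divM.
    case: (ltnP i K1) => _ /=; first by rewrite mul0r addr0.
    by rewrite add0r mul1r ler_pdivlMr // mul1r ler_nat.
  rewrite !big_split /=; apply: lerD; [apply: lerD|].
  - rewrite -mulr_sumr ler_wpM2l //; apply: le_trans (hK K2).
    rewrite big_mkcond [leRHS]big_geq_mkord /= [leRHS]big_mkcond /=.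
    by apply: ler_sum => i _; case: (K <= i)%N => //=; case: ifP => // _; rewrite invr_ge0.
  - rewrite -natr_sum ler_nat.
    apply: (@leq_trans (\sum_(i < K2 | (i < K1)%N) 1)%N).
      rewrite big_mkcond [leqRHS]big_mkcond /=.
      by apply: leq_sum => i _; case: ifP; case: ltnP.
    suff H q : (\sum_(0 <= i < q | (i < K1)%N) 1 <= minn q K1)%N.
      rewrite -(big_mkord (fun i => (i < K1)%N) (fun=> 1%N)).
      by apply: leq_trans (H K2) (geq_minr _ _).
    elim: q => [|q IH]; first by rewrite big_geq.
    rewrite big_mkcond /= big_nat_recr //= -big_mkcond /=; move: IH.
    by case: (ltnP q K1) => *; lia.
  - under eq_bigr do rewrite mulrCA; rewrite -mulr_sumr ler_wpM2l //; apply: le_trans (hK1 K2).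
    rewrite big_mkcond [leRHS]big_geq_mkord /= [leRHS]big_mkcond /=.
    apply: ler_sum => i _; case: (K1 <= i)%N; rewrite ?mul1r ?mul0r;
      case: ifP => //= _; by rewrite invr_ge0.
apply: (@le_lt_trans _ _ (\sum_(j < k)
    (L%:R * (4 * k.+1%:R)^-1 + K1%:R + X%:R * (4 * k.+1%:R * N%:R)^-1))).
  apply: (@le_trans _ _ (\sum_(j < k)
      #|\bigcup_(i < K2 | (K <= i)%N && (b i <= X)%N) bad j i|%SET%:R)).
    by rewrite -natr_sum ler_nat; exact: leq_card_bigcup.
  exact: ler_sum.
rewrite sumr_const card_ord -[ltLHS]mulr_natl.
have L0 : 0 <= L%:R :> R by [].
have k0 : 0 <= k%:R :> R by [].
have N1 : 1 <= N%:R :> R by rewrite ler1n.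
have kk : k%:R * (4 * k.+1%:R)^-1 <= 4^-1 :> R.
  by rewrite invfM mulrCA ler_piMr // ler_pdivrMr ?mul1r ?ler_nat.
have hXN : X%:R * N%:R^-1 <= (c + k)%:R + L%:R :> R.
  rewrite ler_pdivrMr ?ltr0n // /X natrD natrM mulrDl [N%:R * _]mulrC lerD2r.
  by rewrite ler_peMr.
rewrite !mulrDr [in X in _ + X]invfM.
have t1 : k%:R * (L%:R * (4 * k.+1%:R)^-1) <= L%:R * 4^-1 :> R.
  by rewrite mulrCA ler_wpM2l.
have t3 : k%:R * (X%:R * ((4 * k.+1%:R)^-1 * N%:R^-1)) <= 4^-1 * ((c + k)%:R + L%:R) :> R.
  have -> : k%:R * (X%:R * ((4 * k.+1%:R)^-1 * N%:R^-1)) =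
    (k%:R * (4 * k.+1%:R)^-1) * (X%:R * N%:R^-1) :> R by ring.
  by apply: ler_pM => //; rewrite mulr_ge0 // invr_ge0.
have hL : L%:R = 4 * (k%:R * K1%:R + (c + k)%:R) + 1 :> R.
  by rewrite /L -natr1 natrM -addnA natrD natrM.
have kK : 0 <= k%:R * K1%:R :> R by rewrite mulr_ge0.
have ck : 0 <= (c + k)%:R :> R by [].
apply: le_lt_trans (lerD (lerD t1 (lexx _)) t3) _.
move: hL kK ck; move: (L%:R : R) ((c + k)%:R : R) (k%:R * K1%:R : R) => l x y.
clear; lra.
Qed.

(** * The values of [phiB] lie in [X_eta] *)

(** It suffices that [K] exceeds one counterexample for each of the finitely many [j] that have one.
    In use, this selects finitely many [b i] that account for every zero of a block. *)
Lemma forall_stabilizes (Q : nat -> nat -> Prop) (k : nat) :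
  exists K : nat, forall j, (j < k)%N -> (forall i, (i < K)%N -> Q i j) -> forall i, Q i j.
Proof.
elim: k => [|k [K hK]]; first by exists 0%N.
have [h|/existsNP[i0 hi0]] := pselect (forall i, Q i k).
  by exists K => j; rewrite ltnS leq_eqVlt => /predU1P[->|jk] //; exact: hK.
exists (maxn K i0.+1) => j; rewrite ltnS leq_eqVlt => /predU1P[->|jk] h.
  by case: hi0; apply: h; rewrite leq_max ltnSn orbT.
by apply: hK => // i iK; apply: h; rewrite leq_max iK.
Qed.

Lemma dvdz_mod_eq (d x y : int) : (d %| x - y)%Z -> (d %| x)%Z = (d %| y)%Z.
Proof. by move=> h; rewrite -{1}[x](subrK y) rpredDl. Qed.

(* The Chinese remainder theorem produces in eta all zeros of the block, using
   finitely many b_i; the sieve keeps the remaining b_i from adding more. *)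
Lemma phiB_in_X_eta (R : realType) (b : nat -> nat)
  (hb2 : forall i, (2 <= b i)%N)
  (hcop : forall i j, i <> j -> coprime (b i) (b j))
  (hsum : (\sum_(i <oo) ((b i)%:R^-1 : R)%:E < +oo)%E) (w : OmegaT b) :
  X_eta b (phiB w).
Proof.
move=> m k.
pose D i (j : nat) := ((b i)%:Z %| (nat_of_ord (w i))%:Z + (m + j%:Z))%Z.
have [Kw hKw] := forall_stabilizes (fun i j => ~ D i j) k.
have [K0 hK0] := @sieve_progression R b hb2 hsum k.
(* [K0] makes the sieve available beyond [K]; [Kw] ensures that each zero of the block is already
   caused by some [b i] with [i < K]. *)
pose K := maxn K0 Kw; pose N := (\prod_(i < K) b i)%N.
have bN i : (i < K)%N -> (b i %| N)%N.
  by move=> iK; rewrite /N (bigD1 (Ordinal iK)) //= dvdn_mulr.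
have [n [_ hn]] := crt_ord b hb2 hcop
  (fun i => `|((nat_of_ord (w i))%:Z + m) %% (b i)%:Z|%Z)%N K.
have N0 : (0 < N)%N by rewrite prodn_gt0 // => i; apply: ltnW.
(* The sieve wants a positive start; adding [N] to [n] provides it without changing residues modulo
   [b i] for [i < K]. *)
have [|||i Ki|s hs] := hK0 K N (n + N)%N => //.
- by rewrite leq_maxl.
- by rewrite addn_gt0 N0 orbT.
- apply: coprime_prod_ord => j jK; apply: hcop => e.
  by rewrite e leqNgt jK in Ki.
exists (n + N + N * s)%N%:Z => j jk.
have dE i : (i < K)%N -> ((b i)%:Z %| (n + N + N * s)%N%:Z + j%:Z)%Z = D i j.
  move=> iK; apply: dvdz_mod_eq.
  have b0 : (b i)%:Z != 0 by rewrite eqz_nat -lt0n ltnW.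
  have hnm : (n%:Z = (nat_of_ord (w i))%:Z + m %[mod (b i)%:Z])%Z.
    rewrite modz_nat (hn i iK) -modz_nat gez0_abs ?modz_ge0 //.
    by rewrite modz_mod.
  have -> : (n + N + N * s)%N%:Z + j%:Z - ((nat_of_ord (w i))%:Z + (m + j%:Z)) =
     (n%:Z - ((nat_of_ord (w i))%:Z + m)) + (N * s.+1)%N%:Z by lia.
  rewrite rpredD //; first by rewrite -eqz_mod_dvd; apply/eqP.
  by rewrite dvdzE /= dvdn_mulr // bN.
rewrite /phiB /etaB; apply: asbool_equiv_eq; split => h.
- move=> i; case: (ltnP i K) => iK; first by rewrite dE //; exact: h.
  rewrite -PoszD dvdzE /= => d; have := hs i j iK jk.
  by rewrite addnAC d.
- apply: hKw => // i iK; rewrite -dE ?(leq_trans iK) ?leq_maxr //; exact: h.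
Qed.

(** * From integer divisibility to the rings ['Z_p] *)

(** Translates the integer remainders of the definitions into ring arithmetic. The bound on [p]
    matters because ['Z_p] has at least two elements even for [p <= 1]. *)
Lemma intr_Zp_eq (p : nat) (n : int) (r : 'Z_p) : (1 < p)%N ->
  ((n %% p%:Z)%Z = (nat_of_ord r)%:Z) <-> (n%:~R = r).
Proof.
move=> p1; have p0 : p%:Z != 0 by rewrite eqz_nat -lt0n ltnW.
have := modz_ge0 n p0; have := ltz_mod n p0; have := divz_eq n p%:Z.
case: (n %% p%:Z)%Z => // t ne tp _.
have tp' : (t < p)%N by move: tp; rewrite ltz_nat.
have -> : n%:~R = t%:R :> 'Z_p.
  by rewrite ne rmorphD rmorphM /= -!pmulrn pchar_Zp // mulr0 add0r.
split => [[->]|<-]; first exact: natr_Zp.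
by rewrite val_Zp_nat // modn_small.
Qed.

Lemma intr_Zp_eq0 (p : nat) (n : int) : (1 < p)%N ->
  (p%:Z %| n)%Z <-> (n%:~R = 0 :> 'Z_p).
Proof.
by move=> p1; rewrite -intr_Zp_eq //=; split => /dvdz_mod0P.
Qed.

Lemma dvdz_add_Zp (p : nat) (r : 'Z_p) (n : int) : (1 < p)%N ->
  (p%:Z %| (nat_of_ord r)%:Z + n)%Z <-> (r + n%:~R = 0).
Proof. by move=> p1; rewrite intr_Zp_eq0 // rmorphD /= -pmulrn natr_Zp. Qed.

(** * Cylinders and unique ergodicity of the rotation *)

(** By the Chinese remainder theorem, a single integer [n] encodes any choice of the first [K]
    coordinates; in this labelling the rotation by 1 is [n] to [n + 1]. *)
Definition cyl (b : nat -> nat) (K n : nat) : set (OmegaT b) :=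
  [set w | forall i, (i < K)%N -> w i = n%:R].

Definition omega_one (b : nat -> nat) : OmegaT b := @MkOmega b (fun i => 1).

Lemma measurable_coord (b : nat -> nat) (i : nat) (a : 'Z_(b i)) :
  measurable ([set w | w i = a] : set (OmegaT b)).
Proof. by apply: sub_sigma_algebra; exists i, a. Qed.

Lemma measurable_cyl (b : nat -> nat) (K n : nat) : measurable (cyl b K n).
Proof.
have -> : cyl b K n = \bigcap_(i in `I_K) [set w | w i = n%:R] by [].
by apply: bigcap_measurableType => i _; exact: measurable_coord.
Qed.

Lemma cyl_cover (b : nat -> nat) (hb2 : forall i, (2 <= b i)%N)
  (hcop : forall i j, i <> j -> coprime (b i) (b j)) (K : nat) (w : OmegaT b) :
  exists2 n, (n < \prod_(i < K) b i)%N & cyl b K n w.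
Proof.
have [n [nN hn]] := crt_ord b hb2 hcop (fun i => nat_of_ord (w i)) K.
exists n => // i iK; rewrite -[LHS]natr_Zp; apply: val_inj.
by rewrite /= !val_Zp_nat // hn.
Qed.

(** This makes the cylinders, together with the empty set, stable under intersection, as the
    uniqueness theorem for measures requires. *)
Lemma cyl_inter_le (b : nat -> nat) (K K' m n : nat) : (K <= K')%N ->
  cyl b K m `&` cyl b K' n = cyl b K' n \/ cyl b K m `&` cyl b K' n = set0.
Proof.
move=> KK; have [h|h] := pselect (forall i, (i < K)%N -> m%:R = n%:R :> 'Z_(b i)).
  left; apply/setIidr => w hw i iK; rewrite h //; apply: hw; exact: leq_trans KK.
right; rewrite -subset0 => w [h1 h2]; apply: h => i iK.
by rewrite -(h1 i iK) -(h2 i (leq_trans iK KK)).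
Qed.

(* The rotation permutes cyclically the prod b_i cylinders of level K. *)
Lemma cyl_measure (R : realType) (b : nat -> nat)
  (hb2 : forall i, (2 <= b i)%N)
  (hcop : forall i j, i <> j -> coprime (b i) (b j))
  (mu : probability (OmegaT b) R) (hmu : Defs.invariant mu (omega_add (omega_one b)))
  (K n : nat) :
  mu (cyl b K n) = ((\prod_(i < K) b i)%:R^-1)%:E.
Proof.
have hn m : mu (cyl b K m) = mu (cyl b K 0).
  elim: m => // m <-; rewrite -[LHS]hmu; last exact: measurable_cyl.
  congr (mu _); apply/seteqP; split => w h i iK; have := h i iK.
    by rewrite /= -[m.+1]addn1 natrD => /addIr.
  by rewrite /= -[m.+1]addn1 natrD => ->.
rewrite hn; set N := (\prod_(i < K) b i)%N.
have N0 : (0 < N)%N by rewrite prodn_gt0 // => i; apply: ltnW.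
have : mu setT = 1%E by apply: probability_setT.
have -> : setT = \big[setU/set0]_(m < N) cyl b K m.
  rewrite -bigcup_mkord; apply/seteqP; split => // w _.
  by have [m mN hm] := cyl_cover b hb2 hcop K w; exists m.
rewrite measure_bigsetU_ord; last 2 first.
- by move=> i; exact: measurable_cyl.
(* Labels of overlapping cylinders agree modulo every [b i] with [i < K], hence modulo [N], and both
   are below [N]. *)
- move=> p q _ _ [w [hp hq]]; apply: val_inj.
  wlog pq : p q hp hq / (p <= q)%N.
    by move=> H; case/orP: (leq_total p q) => h; [exact: H|apply/esym/H].
  apply/eqP; rewrite eqn_leq pq /= -subn_eq0.
  have : (N %| q - p)%N.
    apply: dvdn_prod_ord => // i iK; rewrite -eqn_mod_dvd //.
    by rewrite -!(val_Zp_nat (hb2 i)) -(hp i iK) -(hq i iK).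
  have qpN : (q - p < N)%N by apply: leq_ltn_trans (ltn_ord q); exact: leq_subr.
  by rewrite /dvdn modn_small.
rewrite (eq_bigr (fun=> mu (cyl b K 0))); last by move=> i _; exact: hn.
have fm : mu (cyl b K 0) \is a fin_num by apply: fin_num_measure; exact: measurable_cyl.
rewrite -(fineK fm) sumEFin sumr_const card_ord => -[e]; congr EFin.
have NR : N%:R != 0 :> R by rewrite pnatr_eq0 -lt0n.
by apply: (mulfI NR); rewrite mulfV // mulr_natl.
Qed.

(** Invariance alone fixes the measure of every cylinder by [cyl_measure], and the cylinders with
    the empty set form a generating pi-system. *)
Lemma odometer_uniquely_ergodic (R : realType) (b : nat -> nat)
  (hb2 : forall i, (2 <= b i)%N)
  (hcop : forall i j, i <> j -> coprime (b i) (b j))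
  (mu1 mu2 : probability (OmegaT b) R) :
  Defs.invariant mu1 (omega_add (omega_one b)) ->
  Defs.invariant mu2 (omega_add (omega_one b)) ->
  forall A, measurable A -> mu1 A = mu2 A.
Proof.
move=> h1 h2 A mA.
pose G : set (set (OmegaT b)) := [set A | A = set0 \/ exists K n, A = cyl b K n].
(* Level 0 imposes no condition, so [cyl b 0 0] is the whole space and its constant sequence is the
   required cover by sets of finite measure. *)
apply: (measure_unique G (fun=> cyl b 0 0) _ _ _ _ mu1 mu2 _ _ A mA).
- apply/seteqP; split.
    apply: smallest_sub; first exact: smallest_sigma_algebra.
    move=> _ [i [a ->]].
    (* Level [i.+1] is the first to constrain coordinate [i]; only the labels [n] that reduce to [a]
       contribute. *)
    have -> : (fun w : OmegaT b => w i = a) =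
        \bigcup_n (if n%:R == a then cyl b i.+1 n else set0).
      apply/seteqP; split => w /=.
        move=> wia; have [n _ hn] := cyl_cover b hb2 hcop i.+1 w.
        by exists n => //=; rewrite -wia (hn i) ?eqxx.
      by move=> [n _]; case: eqP => // <- hn; rewrite hn.
    apply: sigma_algebra_bigcup => n; apply: sub_sigma_algebra.
    by case: ifP => _; [right; exists i.+1, n|left].
  apply: smallest_sub; first exact: sigma_algebra_measurable.
  by move=> _ [->|[K [n ->]]]; [exact: measurable0|exact: measurable_cyl].
- move=> B C [->|[K [m ->]]]; first by rewrite set0I; left.
  move=> [->|[K' [n ->]]]; first by rewrite setI0; left.
  wlog KK : K K' m n / (K <= K')%N.
    move=> H; case/orP: (leq_total K K') => h; first exact: H.
    by rewrite setIC; apply: H.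
  case: (cyl_inter_le b K K' m n KK) => ->; [right|by left].
  by exists K', n.
- by move=> _; right; exists 0%N, 0%N.
- by apply/seteqP; split => // w _; exists 0%N.
- move=> _ [->|[K [n ->]]]; first by rewrite !measure0.
  by rewrite -[LHS]/(mu1 _) -[RHS]/(mu2 _);
    transitivity (((\prod_(i < K) b i)%:R^-1)%:E : \bar R);
      [|symmetry]; exact: cyl_measure.
- by move=> _; exact: le_lt_trans (probability_le1 mu1 (measurable_cyl _ _ _)) (ltry 1).
Qed.

(** * Measurability in the sequence space and residues of supports *)

Lemma measurable_bigcapT_int d (T : measurableType d) (F : int -> set T) :
  (forall n, measurable (F n)) -> measurable (\bigcap_n F n).
Proof.
move=> h; rewrite -[X in measurable X]setCK setC_bigcap; apply: measurableC.
by apply: countable_bigcupT_measurable => // n; apply: measurableC.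
Qed.

Lemma measurable_coord_eq (n : int) (c : bool) :
  measurable ([set x | x n = c] : set BinSeq).
Proof.
have mt : measurable ([set x | x n = true] : set BinSeq).
  by apply: sub_sigma_algebra; exists n.
case: c => //.
have -> : [set x : BinSeq | x n = false] = ~` [set x | x n = true].
  by apply/seteqP; split => x /=; [move=> ->|move/negP/negbTE].
exact: measurableC.
Qed.

Lemma measurable_X_eta (b : nat -> nat) : measurable (X_eta b).
Proof.
have -> : X_eta b = \bigcap_(m : int) \bigcap_(k : nat) \bigcup_(t : int)
    \bigcap_(j in `I_k) [set y : BinSeq | y (m + j%:Z) = etaB b (t + j%:Z)].
  apply/seteqP; split => y h.
    by move=> m _ k _; have [t ht] := h m k; exists t.
  by move=> m k; have [t _ ht] := h m I k I; exists t.
apply: measurable_bigcapT_int => m; apply: bigcapT_measurable => k.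
apply: countable_bigcupT_measurable => // t.
by apply: bigcap_measurableType => j _; exact: measurable_coord_eq.
Qed.

Lemma supp_modP (b : nat -> nat) (hb2 : forall i, (2 <= b i)%N)
    (x : BinSeq) (i : nat) (r : 'Z_(b i)) :
  r \in supp_mod b x i <-> exists n : int, x n = true /\ n%:~R = r.
Proof.
rewrite inE; split => [/asboolP|] [n [xn nr]].
  by exists n; split => //; apply/intr_Zp_eq.
by apply/asboolP; exists n; split => //; apply/intr_Zp_eq.
Qed.

Lemma supp_mod_shift (b : nat -> nat) (hb2 : forall i, (2 <= b i)%N)
    (x : BinSeq) (i : nat) (r : 'Z_(b i)) :
  (r \in supp_mod b (shiftS x) i) = (r + 1 \in supp_mod b x i).
Proof.
apply/idP/idP => /(supp_modP _ hb2)[n [xn nr]]; apply/(supp_modP _ hb2).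
  by exists (n + 1); split => //; rewrite rmorphD /= nr.
exists (n - 1); split; first by rewrite /shiftS subrK.
by rewrite rmorphB /= nr addrK.
Qed.

Lemma measurable_supp_mod_eq (b : nat -> nat) (hb2 : forall i, (2 <= b i)%N)
    (i : nat) (A : {set 'Z_(b i)}) :
  measurable [set x : BinSeq | supp_mod b x i = A].
Proof.
have mr r : measurable [set x : BinSeq | r \in supp_mod b x i].
  have -> : [set x : BinSeq | r \in supp_mod b x i] =
      \bigcup_(n : int) [set x | n%:~R = r /\ x n = true].
    apply/seteqP; split => x /=; first by move=> /(supp_modP _ hb2)[n [xn nr]]; exists n.
    by move=> [n _ [nr xn]]; apply/(supp_modP _ hb2); exists n.
  apply: countable_bigcupT_measurable => // n.
  have [nr|nr] := pselect (n%:~R = r); last first.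
    rewrite [X in measurable X](_ : _ = set0); first exact: measurable0.
    by rewrite -subset0 => x [].
  rewrite [X in measurable X](_ : _ = [set x | x n = true]); first exact: measurable_coord_eq.
  by apply/seteqP; split => x /=; [case|].
have -> : [set x : BinSeq | supp_mod b x i = A] =
    \bigcap_(r : 'Z_(b i)) (if r \in A then [set x : BinSeq | r \in supp_mod b x i]
                            else ~` [set x : BinSeq | r \in supp_mod b x i]).
  apply/seteqP; split => x /=.
    by move=> e r _; case: ifP => /= rA; rewrite e rA.
  move=> h; apply/setP => r; have := h r I; case: ifP => //= _.
  by move/negP/negbTE.
apply: fin_bigcap_measurable => [|r _]; first exact: finite_finset.
by case: ifP => _ //; exact: measurableC.
Qed.

(** [supp_mod b x i] takes finitely many values, each on a measurable set. This covers at once the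
    cardinality condition of [one_missed] and the coordinates of [theta]. *)
Lemma measurable_supp_mod_pred (b : nat -> nat) (hb2 : forall i, (2 <= b i)%N)
    (i : nat) (Q : {set 'Z_(b i)} -> Prop) :
  measurable [set x : BinSeq | Q (supp_mod b x i)].
Proof.
have -> : [set x : BinSeq | Q (supp_mod b x i)] =
    \bigcup_(A in [set A | Q A]) [set x | supp_mod b x i = A].
  apply/seteqP; split => x /=; first by move=> h; exists (supp_mod b x i).
  by move=> [A /= QA ->].
apply: fin_bigcup_measurable => [|A _]; first exact: finite_finset.
exact: measurable_supp_mod_eq.
Qed.

(** * The missed residues and the factor map [theta] *)

(** The default 0 only makes the function total; it is never reached on [one_missed]. *)
Definition missed (b : nat -> nat) (x : BinSeq) (i : nat) : 'Z_(b i) :=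
  odflt 0 [pick r | r \notin supp_mod b x i].

(** The sign comes from [phiB], which vanishes at [n] when [w i + n = 0] for some [i]: the class
    removed at coordinate [i] is minus [w i]. *)
Definition theta (b : nat -> nat) (x : BinSeq) : OmegaT b :=
  @MkOmega b (fun i => - missed b x i).

(** The residue condition of [Yset]. As a set it is exactly shift invariant, and it serves as the
    full-measure domain for the pointwise identities on [theta]. *)
Definition one_missed (b : nat -> nat) : set BinSeq :=
  [set x | forall i, #|supp_mod b x i| = (b i).-1].

Lemma measurable_one_missed (b : nat -> nat) (hb2 : forall i, (2 <= b i)%N) :
  measurable (one_missed b).
Proof.
have -> : one_missed b = \bigcap_i [set x | #|supp_mod b x i| = (b i).-1].
  by apply/seteqP; split => x h => [i _|i]; [|exact: (h i I)].
apply: bigcapT_measurable => i.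
exact: (@measurable_supp_mod_pred b hb2 i (fun A => #|A| = (b i).-1)).
Qed.

Lemma one_missedP (b : nat -> nat) (hb2 : forall i, (2 <= b i)%N)
    (x : BinSeq) (i : nat) (r : 'Z_(b i)) : one_missed b x ->
  (r \notin supp_mod b x i) = (r == missed b x i).
Proof.
move=> /(_ i) hx.
have /eqP/cards1P[r0 er0] : #|~: supp_mod b x i| = 1%N.
  have c : #|'Z_(b i)| = b i by rewrite card_ord Zp_cast.
  by have := cardsC (supp_mod b x i); rewrite hx [RHS]c; have := hb2 i; lia.
have e r' : (r' \notin supp_mod b x i) = (r' == r0).
  by rewrite -[RHS]finset.in_set1 -er0 finset.in_setC.
rewrite e /missed; case: pickP => [r1|/(_ r0)]; first by rewrite e => /eqP ->.
by rewrite e eqxx.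
Qed.

Lemma one_missed_shift (b : nat -> nat) (hb2 : forall i, (2 <= b i)%N) (x : BinSeq) :
  one_missed b (shiftS x) <-> one_missed b x.
Proof.
have e i : #|supp_mod b (shiftS x) i| = #|supp_mod b x i|.
  rewrite -[RHS](card_preimset _ (addIr 1)); congr #|pred_of_set _|.
  by apply/setP => r; rewrite supp_mod_shift // [RHS]finset.inE.
by split => h i; have := h i; rewrite e.
Qed.

(** The shift lowers every residue of the support by 1, hence also the missed one; the sign in
    [theta] turns this into the rotation by plus 1. *)
Lemma theta_shift (b : nat -> nat) (hb2 : forall i, (2 <= b i)%N) (x : BinSeq) :
  one_missed b x -> theta b (shiftS x) = omega_add (omega_one b) (theta b x).
Proof.
move=> hx; congr MkOmega; apply: functional_extensionality_dep => i /=.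
have : missed b (shiftS x) i \notin supp_mod b (shiftS x) i.
  by rewrite one_missedP //; apply/(one_missed_shift _ hb2).
rewrite supp_mod_shift // one_missedP // => /eqP <-.
by rewrite opprD addrNK.
Qed.

Lemma phiB_omega_add (b : nat -> nat) (hb2 : forall i, (2 <= b i)%N) (w : OmegaT b) :
  phiB (omega_add (omega_one b) w) = shiftS (phiB w).
Proof.
apply/funext => n; apply: asbool_equiv_eq; split => h i; apply: contra_not (h i);
  move=> /dvdz_add_Zp e; apply/dvdz_add_Zp => //=; rewrite -(e (hb2 i)) /=.
  by rewrite rmorphD /= -addrA [1 + _]addrC.
by rewrite rmorphD /= -addrA [1 + _]addrC.
Qed.

(** Where [x n] is true, the class of [n] is not the missed one for any [i], so [phiB (theta b x)]
    is true at [n] as well. *)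
Lemma Mmap_phi_theta (b : nat -> nat) (hb2 : forall i, (2 <= b i)%N) (x : BinSeq) :
  one_missed b x -> Mmap (phiB (theta b x), x) = x.
Proof.
move=> hx; apply/funext => n; rewrite /Mmap /=.
case xn : (x n); rewrite ?andbF // andbT; apply/asboolP => i.
move=> /(dvdz_add_Zp _ _ _ (hb2 i)) /= /eqP; rewrite addrC subr_eq0 => /eqP e.
have := one_missedP b hb2 x i (missed b x i) hx; rewrite eqxx => /negP; apply.
by apply/(supp_modP _ hb2); exists n.
Qed.

Lemma measurable_theta (b : nat -> nat) (hb2 : forall i, (2 <= b i)%N) :
  measurable_fun setT (theta b).
Proof.
apply: (@measurability _ _ _ (OmegaT b) _ _ (@omega_gen b)) => // _ [_ [i [a ->]] <-].
rewrite setTI; exact: (@measurable_supp_mod_pred b hb2 i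
  (fun A => - odflt 0 [pick r | r \notin A] = a)).
Qed.

Lemma measurable_phiB (b : nat -> nat) : measurable_fun setT (@phiB b : OmegaT b -> BinSeq).
Proof.
apply: (@measurability _ _ _ BinSeq _ _ bseq_gen) => // _ [_ [n ->] <-]; rewrite setTI.
have -> : @phiB b @^-1` [set x | x n = true] =
    \bigcap_i ~` \bigcup_(a in [set a : 'Z_(b i) | ((b i)%:Z %| (nat_of_ord a)%:Z + n)%Z])
       [set w | w i = a].
  apply/seteqP; split => w.
    by move=> /asboolP h i _ [a /= ha ea]; apply: (h i); rewrite ea.
  by move=> h; apply/asboolP => i d; apply: (h i I); exists (w i).
apply: bigcapT_measurable => i; apply: measurableC.
apply: fin_bigcup_measurable => [|a _]; first exact: finite_finset.
exact: measurable_coord.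
Qed.

(** * Image measures under maps that intertwine almost everywhere *)

Lemma eq_measure_full_set d (T : measurableType d) (R : realType)
    (mu : probability T R) (Y A B : set T) :
  measurable Y -> mu Y = 1%E -> measurable A -> measurable B ->
  A `&` Y = B `&` Y -> mu A = mu B.
Proof.
move=> mY Y1 mA mB AB.
have h C : measurable C -> mu C = mu (C `&` Y).
  move=> mC; rewrite (measureDI mu mC mY).
  rewrite [X in (X + _)%E](_ : _ = 0%E) ?add0e //; apply/eqP.
  rewrite eq_le measure_ge0 andbT.
  have <- : mu (~` Y) = 0%E by rewrite probability_setC // Y1 subee.
  by apply: le_measure; rewrite ?inE; [exact: measurableD|exact: measurableC|move=> x []].
by rewrite (h A) // (h B) // AB.
Qed.

Lemma invariant_distribution d d' (T : measurableType d) (T' : measurableType d')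
    (R : realType) (mu : probability T R) (f : T -> T) (g : T' -> T')
    (h : {mfun T >-> T'}) (Y : set T) :
  measurable_fun setT f -> measurable_fun setT g -> measurable Y -> mu Y = 1%E ->
  (forall x, Y x -> h (f x) = g (h x)) ->
  Defs.invariant mu f -> Defs.invariant (distribution mu h) g.
Proof.
move=> mf mg mY Y1 hfg inv A mA; rewrite /distribution /pushforward /=.
have mhA : measurable (h @^-1` A) by exact: measurable_funPTI.
rewrite -[RHS]inv //; apply: (eq_measure_full_set _ _ _ _ Y) => //.
- by apply: measurable_funPTI; rewrite -[X in measurable X]setTI; exact: mg.
- by rewrite -[X in measurable X]setTI; exact: mf.
by apply/seteqP; split => x [/= hx Yx]; split => //=; move: hx; rewrite hfg.
Qed.

(** [ergodic] tests strictly invariant sets only, and the preimage of an invariant [A] may fail to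
    be one off [Y]. Its intersection with [Y] is strictly invariant, because [Y] is, and has the
    same measure. *)
Lemma ergodic_distribution d d' (T : measurableType d) (T' : measurableType d')
    (R : realType) (mu : probability T R) (f : T -> T) (g : T' -> T')
    (h : {mfun T >-> T'}) (Y : set T) :
  measurable_fun setT f -> measurable_fun setT g -> measurable Y -> mu Y = 1%E ->
  (forall x, Y (f x) <-> Y x) -> (forall x, Y x -> h (f x) = g (h x)) ->
  ergodic mu f -> ergodic (distribution mu h) g.
Proof.
move=> mf mg mY Y1 fY hfg [inv erg]; split; first exact: invariant_distribution hfg inv.
move=> A mA gA; rewrite /distribution /pushforward /=.
have mhA : measurable (h @^-1` A) by exact: measurable_funPTI.
have mB : measurable (h @^-1` A `&` Y) by exact: measurableI.
have e : mu (h @^-1` A `&` Y) = mu (h @^-1` A).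
  by apply: (eq_measure_full_set _ _ _ _ Y) => //; rewrite -setIA setIid.
have := erg _ mB; rewrite e; apply.
apply/seteqP; split => x [/= hx Yx].
  have Yx' := (fY x).1 Yx; split => //=.
  by move: hx; rewrite hfg // -[A in _ -> A _]gA.
split; last exact/fY.
by rewrite /= hfg //; rewrite -gA in hx.
Qed.

(** * Measurability of the shifts, of [Mmap] and of the rotation *)

Lemma measurable_shiftS : measurable_fun setT shiftS.
Proof.
apply: (@measurability _ _ _ BinSeq _ _ bseq_gen) => // _ [_ [n ->] <-]; rewrite setTI.
exact: (measurable_coord_eq (n + 1) true).
Qed.

Lemma measurable_shiftSS : measurable_fun setT shiftSS.
Proof.
by apply: measurable_fun_pair; apply: measurableT_comp => //; exact: measurable_shiftS.
Qed.

Lemma measurable_Mmap : measurable_fun setT Mmap.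
Proof.
apply: (@measurability _ _ _ BinSeq _ _ bseq_gen) => // _ [_ [n ->] <-]; rewrite setTI.
have -> : Mmap @^-1` [set x | x n = true] =
    fst @^-1` [set x : BinSeq | x n = true] `&` snd @^-1` [set x : BinSeq | x n = true].
  by apply/seteqP; split => p; [move=> /andP[]|move=> [/= h1 h2]; apply/andP].
apply: measurableI; rewrite -[X in measurable X]setTI.
  by apply: measurable_fst => //; exact: measurable_coord_eq.
by apply: measurable_snd => //; exact: measurable_coord_eq.
Qed.

Lemma measurable_omega_add_one (b : nat -> nat) :
  measurable_fun setT (omega_add (omega_one b)).
Proof.
apply: (@measurability _ _ _ (OmegaT b) _ _ (@omega_gen b)) => // _ [_ [i [a ->]] <-].
rewrite setTI [X in measurable X](_ : _ = [set w : OmegaT b | w i = a - 1]).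
  exact: measurable_coord.
by apply/seteqP; split => w /=; [move=> <-; rewrite addrK|move=> ->; rewrite subrK].
Qed.

(** * Construction of the joining *)

Theorem mainTheorem3 (R : realType) (b : nat -> nat)
  (hb2 : forall i, (2 <= b i)%N)
  (hcop : forall i j, i <> j -> coprime (b i) (b j))
  (hsum : (\sum_(i <oo) ((b i)%:R^-1 : R)%:E < +oo)%E)
  (P : probability (OmegaT b) R) (hP : is_haar P)
  (nu : probability BinSeq R)
  (hnuX : nu (X_eta b) = 1%E)
  (hnu : ergodic nu shiftS)
  (hnuY : nu (Yset b) = 1%E) :
  exists rho : probability (BinSeq * BinSeq)%type R,
    [/\ rho (X_eta b `*` setT) = 1%E,
        ergodic rho shiftSS,
        (forall A : set BinSeq, measurable A ->
           rho (fst @^-1` A) = P (phiB (b:=b) @^-1` A)) &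
        (forall A : set BinSeq, measurable A ->
           rho (Mmap @^-1` A) = nu A)].
Proof.
have mY := measurable_one_missed b hb2.
have Y1 : nu (one_missed b) = 1%E.
  apply/eqP; rewrite eq_le probability_le1 //= -hnuY; apply: le_measure.
  - by rewrite inE; apply: measurableI => //; exact: measurable_X_eta.
  - by rewrite inE.
  - by move=> x [].
have mth := measurable_theta b hb2.
pose th : {mfun BinSeq >-> OmegaT b} := mfun_Sub (mem_set mth).
have mF : measurable_fun setT (fun x : BinSeq => (phiB (theta b x) : BinSeq, x)).
  apply: measurable_fun_pair => //.
  exact: (measurableT_comp (measurable_phiB b) mth).
pose F : {mfun BinSeq >-> (BinSeq * BinSeq)%type} := mfun_Sub (mem_set mF).
have thP A : measurable A -> nu (theta b @^-1` A) = P A.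
  apply: (odometer_uniquely_ergodic R b hb2 hcop (distribution nu th) P).
    apply: (@invariant_distribution _ _ _ _ _ _ shiftS _ _ (one_missed b)) => //.
    - exact: measurable_shiftS.
    - exact: measurable_omega_add_one.
    - by move=> x Yx; exact: theta_shift.
    - by case: hnu.
  by move=> B mB; exact: hP.
exists (distribution nu F); split.
(* [phiB] lands in [X_eta] at every point, so the preimage is the whole space. *)
- rewrite /= /distribution /pushforward [X in nu X](_ : _ = setT) ?probability_setT //.
  by apply/seteqP; split => // x _; split => //=; exact: phiB_in_X_eta hsum _.
- apply: (@ergodic_distribution _ _ _ _ _ _ shiftS _ _ (one_missed b)) => //.
  + exact: measurable_shiftS.
  + exact: measurable_shiftSS.
  + by move=> x; exact: one_missed_shift.
  + move=> x Yx; rewrite /= /shiftSS /=; congr pair.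
    by rewrite theta_shift // phiB_omega_add.
- move=> A mA; rewrite /= /distribution /pushforward /=.
  rewrite -thP // -[X in measurable X]setTI; exact: measurable_phiB.
- move=> A mA; rewrite /= /distribution /pushforward /=.
  (* [Mmap] after [F] is shown to be the identity on [one_missed] only, so the two sets are compared
     there. *)
  apply: (eq_measure_full_set _ _ _ nu (one_missed b)) => //.
    rewrite -[X in measurable X]setTI.
    exact: (measurableT_comp measurable_Mmap mF).
  by apply/seteqP; split => x [/= h Yx]; split => //; move: h; rewrite /= Mmap_phi_theta.
Qed.
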